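(* Let $Sp_2^0(\mathbb{Z})=\mathrm{Stab}_{Sp_2(\mathbb{Z})}(q_{0,0})$ and $Sp_2^1(\mathbb{Z})=\mathrm{Stab}_{Sp_2(\mathbb{Z})}(q_{1,1})$. Then: (i) $H_1(Sp_2(\mathbb{Z});\mathbb{Z})=\mathbb{Z}/12\{t\}$, where $t$ is represented by $\begin{pmatrix} 1 & 1 \\ 0 & 1 \end{pmatrix} \in Sp_2(\mathbb{Z})$. (ii) $H_1(Sp_2^0(\mathbb{Z});\mathbb{Z})=\mathbb{Z}\{\mu\} \oplus \mathbb{Z}/4\{\lambda\}$, where $\mu$ is represented by $\begin{pmatrix} 1 & 2 \\ 0 & 1 \end{pmatrix} \in Sp_2^0(\mathbb{Z})$ and $\lambda$ is represented by $\begin{pmatrix} 0 & -1 \\ 1 & 0 \end{pmatrix} \in Sp_2^0(\mathbb{Z})$. (iii) $H_1(Sp_2^1(\mathbb{Z});\mathbb{Z})=\mathbb{Z}/12\{t'\}$, where $t'$ is represented by $\begin{pmatrix} 1 & 1 \\ 0 & 1 \end{pmatrix} \in Sp_2^1(\mathbb{Z})$.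
   Context: $\Omega_1=\begin{pmatrix}0&1\\-1&0\end{pmatrix}$ is the standard symplectic form on $\mathbb{Z}^2$ with standard basis $(\alpha,\beta)$, and $Sp_2(\mathbb{Z})=\mathrm{Aut}(\mathbb{Z}^2,\Omega_1)$. A quadratic refinement is a function $q:\mathbb{Z}^2\to\mathbb{Z}/2$ with $q(x+y)\equiv q(x)+q(y)+\Omega_1(x,y)\pmod2$; $Sp_2(\mathbb{Z})$ acts on the right on these by precomposition. $q_{i,j}$ is the quadratic refinement with $q_{i,j}(\alpha)=i$, $q_{i,j}(\beta)=j$; its Arf invariant is $ij$. $R\{u\}$ denotes the cyclic group $R$ generated by $u$. *)

(* Defs.v *)
From HB Require Import structures.
From mathcomp Require Import all_boot all_order all_algebra ring_quotient.
From mathcomp Require Import ring boolp.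
From mathcomp Require Import freeg.

Set Implicit Arguments.
Unset Strict Implicit.
Unset Printing Implicit Defensive.

Import GRing.Theory.
Local Open Scope ring_scope.

(* H_1(G; Z) is the degree-one homology of the unnormalized bar complex with  *)
(* trivial coefficients                                                       *)
(*     Z[G x G] --bar_d2--> Z[G] --bar_d1--> Z[pt]                            *)
(*   d2 [g | h] = [h] - [g h] + [g],    d1 [g] = [] - [].                     *)

Section GroupHomology.
Variable G : groupType.

Definition bar_d1 : {freeg G} -> {freeg unit} :=
  fglift (fun _ : G => << tt >> - << tt >> : {freeg unit}).

Definition bar_d2 : {freeg (G * G)%type} -> {freeg G} :=
  fglift (fun u : G * G =>
    << u.2 >> - << (u.1 * u.2)%g >> + << u.1 >> : {freeg G}).

Lemma bar_d1_zmod_morphism : zmod_morphism bar_d1.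
Proof. exact: lift_is_additive. Qed.
HB.instance Definition _ :=
  GRing.isZmodMorphism.Build _ _ bar_d1 bar_d1_zmod_morphism.

Lemma bar_d2_zmod_morphism : zmod_morphism bar_d2.
Proof. exact: lift_is_additive. Qed.
HB.instance Definition _ :=
  GRing.isZmodMorphism.Build _ _ bar_d2 bar_d2_zmod_morphism.

Definition cycle1 : {pred {freeg G}} := fun c => bar_d1 c == 0.

Lemma cycle1_closed : zmod_closed cycle1.
Proof.
split=> [|x y]; rewrite !unfold_in; first by rewrite raddf0.
by move=> /eqP dx /eqP dy; rewrite raddfB /= dx dy subrr.
Qed.

HB.instance Definition _ :=
  GRing.isZmodClosed.Build {freeg G} cycle1 cycle1_closed.

Record Z1 := MkZ1 { Z1val : {freeg G}; _ : Z1val \in cycle1 }.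

HB.instance Definition _ := [isSub for Z1val].
HB.instance Definition _ := [Choice of Z1 by <:].
HB.instance Definition _ := [SubChoice_isSubZmodule of Z1 by <:].

Definition boundary1 : {pred Z1} := fun z => `[< exists b, val z = bar_d2 b >].

Lemma boundary1_closed : zmod_closed boundary1.
Proof.
split=> [|x y]; rewrite !unfold_in.
  by apply/asboolP; exists 0; rewrite !raddf0.
move=> /asboolP[b xb] /asboolP[c yc]; apply/asboolP; exists (b - c).
by rewrite !raddfB /= xb yc.
Qed.

HB.instance Definition _ :=
  GRing.isZmodClosed.Build Z1 boundary1 boundary1_closed.

Definition H1 : zmodType := {ideal_quot boundary1}.

Lemma cycle1_generator (g : G) : << g >> \in cycle1.
Proof. by rewrite unfold_in /bar_d1 liftU subrr scaler0. Qed.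

Definition H1_class (g : G) : H1 :=
  (\pi_({ideal_quot boundary1}) (MkZ1 (cycle1_generator g)))%qT.

End GroupHomology.

(* Matrices act on column vectors on the left; alpha, beta are the basis.     *)

Definition mx22 (a b c d : int) : 'M[int]_2 :=
  \matrix_(i, j) if i == 0 then if j == 0 then a else b
                 else if j == 0 then c else d.

Definition Omega1 : 'M[int]_2 := mx22 0 1 (-1) 0.

Definition omega1 (x y : 'cV[int]_2) : int := (x^T *m Omega1 *m y) 0 0.

Definition alpha : 'cV[int]_2 := delta_mx 0 0.
Definition beta : 'cV[int]_2 := delta_mx 1 0.

Definition symplectic : {pred 'M[int]_2} := fun A =>
  (A \in unitmx) && `[< forall x y, omega1 (A *m x) (A *m y) = omega1 x y >].

Record Sp2 := MkSp2 { Sp2val : 'M[int]_2; _ : Sp2val \in symplectic }.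

HB.instance Definition _ := [isSub for Sp2val].
HB.instance Definition _ := [Choice of Sp2 by <:].

Lemma symplectic1 : 1%:M \in symplectic.
Proof.
by apply/andP; split; [exact: unitmx1|apply/asboolP => x y; rewrite !mul1mx].
Qed.

Lemma symplecticM A B :
  A \in symplectic -> B \in symplectic -> A *m B \in symplectic.
Proof.
move=> /andP[uA /asboolP pA] /andP[uB /asboolP pB]; apply/andP; split.
  by rewrite unitmx_mul uA uB.
by apply/asboolP => x y; rewrite -!mulmxA pA pB.
Qed.

Lemma symplecticV A : A \in symplectic -> invmx A \in symplectic.
Proof.
move=> /andP[uA /asboolP pA]; apply/andP; split; first by rewrite unitmx_inv.
by apply/asboolP => x y; rewrite -pA !mulKVmx.
Qed.

Definition Sp2_one : Sp2 := MkSp2 symplectic1.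
Definition Sp2_mul (g h : Sp2) : Sp2 := MkSp2 (symplecticM (valP g) (valP h)).
Definition Sp2_inv (g : Sp2) : Sp2 := MkSp2 (symplecticV (valP g)).

Lemma Sp2_mulA : associative Sp2_mul.
Proof. by move=> g h k; apply: val_inj; rewrite /= mulmxA. Qed.
Lemma Sp2_mul1g : left_id Sp2_one Sp2_mul.
Proof. by move=> g; apply: val_inj; rewrite /= mul1mx. Qed.
Lemma Sp2_mulg1 : right_id Sp2_one Sp2_mul.
Proof. by move=> g; apply: val_inj; rewrite /= mulmx1. Qed.
Lemma Sp2_mulVg : left_inverse Sp2_one Sp2_inv Sp2_mul.
Proof.
by move=> g; apply: val_inj; case/andP: (valP g) => ug _; rewrite /= mulVmx.
Qed.
Lemma Sp2_mulgV : right_inverse Sp2_one Sp2_inv Sp2_mul.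
Proof.
by move=> g; apply: val_inj; case/andP: (valP g) => ug _; rewrite /= mulmxV.
Qed.

HB.instance Definition _ :=
  isGroup.Build Sp2 Sp2_mulA Sp2_mul1g Sp2_mulg1 Sp2_mulVg Sp2_mulgV.

Definition is_quadratic_refinement (q : 'cV[int]_2 -> 'Z_2) : Prop :=
  forall x y, q (x + y) = q x + q y + (omega1 x y)%:~R.

Record quadratic_refinement := QuadraticRefinement {
  quad_fun :> 'cV[int]_2 -> 'Z_2;
  quad_funP : is_quadratic_refinement quad_fun }.

Lemma quad_act_subproof (q : quadratic_refinement) (g : Sp2) :
  is_quadratic_refinement (fun x => q (val g *m x)).
Proof.
move=> x y; rewrite mulmxDr quad_funP.
by case/andP: (valP g) => _ /asboolP ->.
Qed.

Definition quad_act (q : quadratic_refinement) (g : Sp2) :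
    quadratic_refinement := QuadraticRefinement (quad_act_subproof q g).

Lemma quad_ext (p q : quadratic_refinement) : p =1 q -> p = q.
Proof.
case: p q => [p hp] [q hq] /= /funext pq; subst q.
by congr QuadraticRefinement; exact: Prop_irrelevance.
Qed.

Lemma quad_act1 q : quad_act q 1%g = q.
Proof. by apply: quad_ext => x /=; rewrite mul1mx. Qed.

Lemma quad_actM q (g h : Sp2) :
  quad_act q (g * h)%g = quad_act (quad_act q g) h.
Proof. by apply: quad_ext => x /=; rewrite mulmxA. Qed.

Lemma omega1E x y : omega1 x y = x 0 0 * y 1 0 - x 1 0 * y 0 0.
Proof.
rewrite /omega1 !mxE !big_ord_recl !big_ord0 !mxE.
rewrite !big_ord_recl !big_ord0 !mxE /=.
have -> : fintype.lift ord0 ord0 = 1 :> 'I_2 by apply: val_inj.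
by rewrite !(mulr0, mulr1, mulrN1, addr0, add0r, mulNr) addrC.
Qed.

Lemma quad_ij_subproof (i j : 'Z_2) : is_quadratic_refinement (fun x =>
  i * (x 0 0)%:~R + j * (x 1 0)%:~R + (x 0 0)%:~R * (x 1 0)%:~R).
Proof.
move=> x y; rewrite !mxE omega1E.
rewrite !(rmorphD, rmorphM, rmorphN) /=.
have opp2 (z : 'Z_2) : - z = z.
  by apply/eqP; rewrite -subr_eq0 -opprD oppr_eq0 -mulr2n -mulr_natr
    pchar_Zp ?mulr0.
rewrite opp2; ring.
Qed.

(* By [quad_ij_unique], the only refinement with values i at alpha, j at beta. *)
Definition quad_ij (i j : 'Z_2) : quadratic_refinement :=
  QuadraticRefinement (quad_ij_subproof i j).

Lemma quad_ij_alpha i j : quad_ij i j alpha = i.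
Proof. by rewrite /= !mxE /= mulr1 !mulr0 !addr0. Qed.

Lemma quad_ij_beta i j : quad_ij i j beta = j.
Proof. by rewrite /= !mxE /= mulr1 mulr0 mul0r addr0 add0r. Qed.

Lemma quad_ij_unique (q : quadratic_refinement) :
  q = quad_ij (q alpha) (q beta).
Proof.
set p := quad_ij _ _; pose d x := q x - p x.
have dB : zmod_morphism d.
  have dD x y : d (x + y) = d x + d y by rewrite /d !quad_funP; ring.
  have d0 : d 0 = 0 by apply: (@addrI _ (d 0)); rewrite -dD !addr0.
  move=> x y; rewrite dD; congr (_ + _); apply/eqP.
  by rewrite -addr_eq0 -dD addNr d0.
pose D := GRing.isZmodMorphism.Build _ _ d dB.
pose f : {additive 'cV[int]_2 -> 'Z_2} := HB.pack d D.
apply: quad_ext => x; apply/eqP; rewrite -subr_eq0; change (f x == 0).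
have -> : x = alpha *~ (x 0 0) + beta *~ (x 1 0).
  apply/colP => i; rewrite -!scaler_int !mxE !intz.
  by case: i => [[|[|?]] ?] //=;
    rewrite !(mulr0, mulr1, addr0, add0r); congr (x _ _); apply: val_inj.
have fa : f alpha = 0 by rewrite /f /= /d quad_ij_alpha subrr.
have fb : f beta = 0 by rewrite /f /= /d quad_ij_beta subrr.
by rewrite raddfD !raddfMz fa fb !mul0rz addr0.
Qed.

Definition stabilizer (q : quadratic_refinement) : {pred Sp2} :=
  fun g => `[< quad_act q g = q >].

Lemma stabilizer_closed q : group_closed (stabilizer q).
Proof.
split=> [|g h]; rewrite !unfold_in; first by apply/asboolP; exact: quad_act1.
move=> /asboolP qg /asboolP qh; apply/asboolP.
by rewrite quad_actM qg -{1}qh -quad_actM mulgV quad_act1.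
Qed.

Record Stab q := MkStab { Stabval : Sp2; _ : Stabval \in stabilizer q }.

Section StabGroup.
Variable q : quadratic_refinement.
HB.instance Definition _ := [isSub for @Stabval q].
HB.instance Definition _ := [Choice of Stab q by <:].
HB.instance Definition _ :=
  SubChoice_isSubGroup.Build Sp2 (stabilizer q) (Stab q) (stabilizer_closed q).
End StabGroup.

Definition Sp2_0 : groupType := Stab (quad_ij 0 0).
Definition Sp2_1 : groupType := Stab (quad_ij 1 1).

(* Main.v *)
From HB Require Import structures.
Require Import Defs.
From mathcomp Require Import all_boot all_order all_algebra.
From mathcomp Require Import ring_quotient freeg boolp zify ring.

(** Degree-one homology is the abelianization: H_1(G) is spanned by the classes
    [g], which are additive in g, and homomorphisms from G to an abelian group
    factor through it. To compute H_1(G) it is therefore enough to have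
    generators of G, relations that bound the abelianization from above, and a
    homomorphism to the expected group that bounds it from below
    ([H1_bijective]).

    Write S = (0 -1; 1 0) and T = (1 1; 0 1). The preimage in SL_2(Z) of the
    group {1, S} modulo 2 is the stabilizer of q_(0,0), the theta group. The
    Euclidean algorithm with even quotients on the first row shows that S and
    T^2 generate it ([theta_descent]); the quotients never get stuck, because
    one entry of the row is odd and the other is even. As the theta group has
    three cosets, represented by words in S and T, it follows that S and T
    generate SL_2(Z) ([SL2_descent]).

    For SL_2(Z) the relations S^4 = 1 and (S T)^3 = S^2 give S = T^-3 and
    T^12 = 1 in the abelianization. The lower bound is a character of order 12
    given by a polynomial in the entries ([chi]); being a congruence, its
    compatibility with the two generators is a finite check
    ([chi_step_mod12]). The form q_(1,1) is 1 on every vector that is nonzero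
    modulo 2, so its stabilizer is the whole group and has the same homology.

    For the theta group the relation S^4 = 1 is the only one that survives in
    the abelianization, and the point is to find a homomorphism onto Z that
    sends T^2 to 1 and S to 0. No congruence can define it. It is the total
    exponent of T^2 in the word produced by the Euclidean algorithm
    ([shear_count]): the algorithm is symmetric under S
    ([shear_count_rot]), and multiplication by T^2 adds or removes exactly its
    first step ([shear_count_shear]). Together with the reduction of the
    order 12 character modulo 4 this gives the isomorphism with Z + Z/4. *)

Set Implicit Arguments.
Unset Strict Implicit.
Unset Printing Implicit Defensive.

Import Order.TTheory GRing.Theory Num.Theory.
Local Open Scope ring_scope.

(** * First homology as abelianization *)

(** Integral combinations of basis elements are reached from them by iterated
    differences, so closure under subtraction is the only inductive step. *)
Lemma freeg_subr_ind (K : choiceType) (P : {freeg K} -> Prop) :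
    P 0 -> (forall x y, P x -> P y -> P (x - y)) -> (forall k, P << k >>) ->
  forall D, P D.
Proof.
move=> P0 PB PU D; have PN x : P x -> P (- x) by rewrite -sub0r; apply: PB.
have PD x y : P x -> P y -> P (x + y).
  by move=> Px Py; rewrite -[y]opprK; apply/PB/PN.
have PMn x n : P x -> P (x *+ n).
  by move=> Px; elim: n => [|n IHn]; rewrite ?mulr0n // mulrS; apply: PD.
rewrite -[D]freeg_sumE; apply: (big_ind P) => // k _.
rewrite -[coeff k D]intz -freegU_mulz.
by case: (coeff k D) => n; rewrite ?NegzE ?mulrNz; [|apply: PN]; apply: PMn.
Qed.

Section H1Theory.
Variable G : groupType.

Lemma bar_d2U (g h : G) :
  bar_d2 << (g, h) >> = << h >> - << (g * h)%g >> + << g >>.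
Proof. by rewrite /bar_d2 liftU scale1r. Qed.

Lemma H1_classM (g h : G) : H1_class (g * h)%g = H1_class g + H1_class h.
Proof.
rewrite /H1_class -[RHS]raddfD; apply/eqP; rewrite -Quotient.idealrBE.
apply/asboolP; exists (- << (g, h) >>).
rewrite raddfN /= bar_d2U.
by rewrite [in RHS]addrAC opprB [<< h >> + _]addrC.
Qed.

Lemma H1_class1 : H1_class 1%g = 0 :> H1 G.
Proof. by apply: (@addrI _ (H1_class 1%g)); rewrite -H1_classM mulg1 addr0. Qed.

(** With trivial coefficients d1 vanishes, so every 1-chain is a cycle and H_1
    is spanned by the classes of group elements. *)
Lemma H1_ind (P : H1 G -> Prop) :
    P 0 -> (forall x y, P x -> P y -> P (x - y)) ->
    (forall g, P (H1_class g)) ->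
  forall x, P x.
Proof.
move=> P0 PB PU x; rewrite -[x]reprK; move: (repr x) => [c c1].
have cycleT (d : {freeg G}) : d \in @cycle1 G.
  elim/freeg_subr_ind: d => [|d e|g]; [exact: rpred0|exact: rpredB|].
  exact: cycle1_generator.
have -> : MkZ1 c1 = MkZ1 (cycleT c) by apply: val_inj.
elim/freeg_subr_ind: c {c1} => [|d e Pd Pe|g].
- have -> : MkZ1 (cycleT 0) = 0 by apply: val_inj.
  by rewrite raddf0.
- have -> : MkZ1 (cycleT (d - e)) = MkZ1 (cycleT d) - MkZ1 (cycleT e).
    by apply: val_inj; rewrite raddfB.
  by rewrite raddfB; apply: PB.
- have -> : MkZ1 (cycleT << g >>) = MkZ1 (cycle1_generator g) by apply: val_inj.
  exact: PU.
Qed.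

Lemma freeg_lift (K : choiceType) (A : zmodType) (chi : K -> A) :
  exists L : {additive {freeg K} -> A}, forall k, L << k >> = chi k.
Proof.
pose L : {freeg K} -> zmodule A := fglift (chi : K -> zmodule A).
have LB : zmod_morphism (L : {freeg K} -> A).
  by move=> x y; apply: (@lift_is_additive int K (zmodule A) chi).
pose Lm := GRing.isZmodMorphism.Build _ A L LB.
pose f : {additive {freeg K} -> A} := HB.pack (L : {freeg K} -> A) Lm.
by exists f => k; rewrite /f /= /L liftU scale1r.
Qed.

(** The universal property H_1(G) = G^ab: the linear extension of a homomorphism
    kills d2 [g | h] precisely by multiplicativity. *)
Lemma H1_lift (A : zmodType) (chi : G -> A) :
    (forall g h, chi (g * h)%g = chi g + chi h) ->
  exists F : {additive H1 G -> A}, forall g, F (H1_class g) = chi g.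
Proof.
move=> chiM; have [L LU] := freeg_lift chi.
have L_bound b : L (bar_d2 b) = 0.
  elim/freeg_subr_ind: b => [|b c Lb Lc|[g h]]; first by rewrite !raddf0.
    by rewrite !raddfB /= Lb Lc subrr.
  by rewrite bar_d2U raddfD raddfB /= !LU chiM addrAC [chi h + _]addrC subrr.
pose F (x : H1 G) : A := L (val (repr x)).
have F_pi z : F (\pi_({ideal_quot @boundary1 G}) z)%qT = L (val z).
  apply/eqP; rewrite -subr_eq0 /F -!raddfB /=; apply/eqP.
  suff /asboolP[b zb] :
      repr (\pi_({ideal_quot @boundary1 G}) z)%qT - z \in @boundary1 G.
    exact: etrans (congr1 L zb) (L_bound b).
  by rewrite Quotient.idealrBE reprK.
have FB : zmod_morphism F.
  move=> x y; rewrite -[x]reprK -[y]reprK -raddfB !F_pi.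
  by rewrite !raddfB.
pose Fm := GRing.isZmodMorphism.Build _ _ F FB.
pose f : {additive H1 G -> A} := HB.pack F Fm.
by exists f => g; rewrite /f /= F_pi LU.
Qed.

(** How H_1 is identified below: [f] is the candidate presentation and [chi] the
    computable invariant. The two remaining hypotheses make [f] and the map
    induced by [chi] mutually inverse, the second one being an equality of
    homomorphisms that needs to be tested on generators only. *)
Lemma H1_bijective (A : zmodType) (f : {additive A -> H1 G}) (chi : G -> A) :
    (forall g h, chi (g * h)%g = chi g + chi h) ->
    (forall a, exists g, chi g = a) ->
    (forall g, f (chi g) = H1_class g) ->
  bijective f.
Proof.
move=> chiM chi_surj f_chi; have [F F_class] := H1_lift chiM.
exists F => [a|x]; first by have [g <-] := chi_surj a; rewrite f_chi F_class.
elim/H1_ind: x => [|x y fx fy|g]; first by rewrite !raddf0.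
  by rewrite !raddfB fx fy.
by rewrite F_class f_chi.
Qed.

End H1Theory.

(** * Homomorphisms tested on two generators *)

(** Generation as an induction principle. The equivalences cover inverses: going
    from [g * s] back to [g] is multiplication by [s^-1]. *)
Definition generated_by2 (G : groupType) (s t : G) : Prop :=
  forall P : G -> Prop, P 1%g ->
    (forall g, P (g * s)%g <-> P g) -> (forall g, P (g * t)%g <-> P g) ->
  forall g, P g.

Lemma morph_mul1 (G : groupType) (A : zmodType) (phi : G -> A) :
  (forall g h, phi (g * h)%g = phi g + phi h) -> phi 1%g = 0.
Proof.
by move=> phiM; apply: (@addrI _ (phi 1%g)); rewrite -phiM mulg1 addr0.
Qed.

Lemma morph_mulX (G : groupType) (A : zmodType) (phi : G -> A) :
    (forall g h, phi (g * h)%g = phi g + phi h) ->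
  forall g n, phi (g ^+ n)%g = phi g *+ n.
Proof.
move=> phiM g; elim=> [|n IHn]; first by rewrite expg0 morph_mul1.
by rewrite expgSr phiM IHn mulrSr.
Qed.

Lemma morph_mulV (G : groupType) (A : zmodType) (phi : G -> A) :
    (forall g h, phi (g * h)%g = phi g + phi h) ->
  forall g, phi g^-1%g = - phi g.
Proof.
by move=> phiM g; apply/eqP; rewrite -addr_eq0 -phiM mulVg morph_mul1.
Qed.

Section Generators.
Variables (G : groupType) (A : zmodType) (s t : G).
Hypothesis gen_st : generated_by2 s t.

(** A function given by a formula is a homomorphism as soon as the formula
    behaves well under right multiplication by the two generators. *)
Lemma gen2_morphism (phi : G -> A) :
    phi 1%g = 0 ->
    (forall g, phi (g * s)%g = phi g + phi s) ->
    (forall g, phi (g * t)%g = phi g + phi t) ->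
  forall g h, phi (g * h)%g = phi g + phi h.
Proof.
move=> phi1 phis phit g h; move: h g.
apply: gen_st => [g|h|h]; first by rewrite mulg1 phi1 addr0.
  by split=> phi_h g; have := phi_h g; rewrite mulgA !phis addrA;
    [move/addIr|move->].
by split=> phi_h g; have := phi_h g; rewrite mulgA !phit addrA;
  [move/addIr|move->].
Qed.

Lemma gen2_eq (phi psi : G -> A) :
    (forall g h, phi (g * h)%g = phi g + phi h) ->
    (forall g h, psi (g * h)%g = psi g + psi h) ->
  phi s = psi s -> phi t = psi t -> phi =1 psi.
Proof.
move=> phiM psiM phi_s phi_t; apply: gen_st => [|g|g].
- by rewrite !morph_mul1.
- by rewrite phiM psiM phi_s; split=> [/addIr|->].
- by rewrite phiM psiM phi_t; split=> [/addIr|->].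
Qed.

End Generators.

(** * Homomorphisms out of Z/n and Z + Z/n *)

Lemma Zp_lift n (A : zmodType) (x : A) : (1 < n)%N -> x *+ n = 0 ->
  exists f : {additive 'Z_n -> A}, f 1 = x.
Proof.
move=> n_gt1 xn0; pose f (k : 'Z_n) := x *+ k.
have f_mod k : x *+ (k %% (Zp_trunc n).+2) = x *+ k.
  by rewrite [in RHS](divn_eq k (Zp_trunc n).+2) {3}Zp_cast // mulrnDr mulnC
    mulrnA xn0 mul0rn add0r.
have fD : {morph f : k l / k + l} by move=> k l; rewrite /f /= f_mod mulrnDr.
have fB : zmod_morphism f.
  by move=> k l; apply: (@addIr _ (f l)); rewrite -fD !subrK.
pose fm := GRing.isZmodMorphism.Build _ _ f fB.
by exists (HB.pack f fm : {additive 'Z_n -> A}); rewrite /= /f /= mulr1n.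
Qed.

Lemma intZp_lift n (A : zmodType) (x y : A) : (1 < n)%N -> y *+ n = 0 ->
  exists f : {additive (int * 'Z_n)%type -> A}, f (1, 0) = x /\ f (0, 1) = y.
Proof.
move=> n_gt1 yn0; have [fy fy1] := Zp_lift n_gt1 yn0.
pose f (u : int * 'Z_n) := x *~ u.1 + fy u.2.
have fB : zmod_morphism f.
  by move=> u v; rewrite /f /= mulrzBr raddfB opprD addrACA.
pose fm := GRing.isZmodMorphism.Build _ _ f fB.
exists (HB.pack f fm : {additive (int * 'Z_n)%type -> A}).
by rewrite /= /f /= raddf0 mulr1z addr0 add0r.
Qed.

Lemma pairMn (A B : zmodType) (x : A) (y : B) n :
  (x, y) *+ n = (x *+ n, y *+ n).
Proof. by elim: n => [|n IHn]; rewrite ?mulr0n // !mulrS IHn. Qed.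

(** * The character of order 12 *)

(** The character of SL_2(Z) of order 12, as a polynomial in the entries; it
    takes the values 1 and -3 at T = (1 1; 0 1) and S = (0 -1; 1 0). If c is
    a unit modulo 3 or 4 then c^2 = 1 there, only c (a + d - 3) survives, and
    this is the value forced by the Bruhat factorization
    g = T^(a/c) S^(c) T^(d/c), with S^(c) standing for S if c = 1 and for S^-1
    if c = -1. The term with factor 1 - c^2 supplies the value when c is
    not a unit, for instance b d for g = T^b or g = - T^(- b) modulo 3. *)
Definition chi (R : pzRingType) (a b c d : R) : R :=
  (1 - c ^+ 2) * (b * d + 3 * (c - 1) * d + c + 3) + c * (a + d - 3).

Lemma chi_intr n (a b c d : int) :
  (chi a b c d)%:~R = chi a%:~R b%:~R c%:~R d%:~R :> 'Z_n.
Proof.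
by rewrite /chi !(rmorphD, rmorphM, rmorphN, rmorphXn, rmorph1, rmorph_nat).
Qed.

Lemma intr_Zp_eq0 n (x : int) : (1 < n)%N -> (x%:~R == 0 :> 'Z_n) = (n %| x)%Z.
Proof.
move=> n_gt1; have nE := Zp_cast n_gt1.
have natr0 m : (m%:R == 0 :> 'Z_n) = (n %| m)%N.
  by rewrite -val_eqE /= val_Zp_nat.
case: x => m; first exact: natr0.
by rewrite NegzE rmorphN oppr_eq0 natr0 dvdzE abszN.
Qed.

(** Quantification over Z/n through an explicit list, which unlike the
    enumeration of a finite type can be evaluated. *)
Definition all_Zp n (P : pred 'Z_n) :=
  all P [seq inZp i | i <- iota 0 (Zp_trunc n).+2].

Lemma all_ZpP n (P : pred 'Z_n) : all_Zp P -> forall x, P x.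
Proof.
move=> /allP allP x; apply: allP; apply/mapP.
by exists (val x); rewrite ?valZpK // mem_iota /=.
Qed.

Definition chi_steps n (a b c d : 'Z_n) : bool :=
  (a * d - b * c == 1) ==>
  (chi a (a + b) c (c + d) == chi a b c d + 1) &&
  (chi b (- a) d (- c) == chi a b c d - 3).

Lemma chi_steps_ZpP n :
    all_Zp (fun a => all_Zp (fun b => all_Zp (fun c => all_Zp (fun d =>
      @chi_steps n a b c d)))) ->
  forall a b c d, @chi_steps n a b c d.
Proof.
move=> H a b c d.
exact: (all_ZpP (all_ZpP (all_ZpP (all_ZpP H a) b) c) d).
Qed.

Lemma chi_stepsP n (a b c d : int) : (1 < n)%N ->
    (forall a b c d, @chi_steps n a b c d) -> a * d - b * c = 1 ->
  (n %| chi a (a + b) c (c + d) - chi a b c d - 1)%Z /\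
  (n %| chi b (- a) d (- c) - chi a b c d + 3)%Z.
Proof.
move=> n_gt1 /(_ a%:~R b%:~R c%:~R d%:~R) /implyP steps det1.
have /steps/andP[/eqP T /eqP S] : a%:~R * d%:~R - b%:~R * c%:~R == 1 :> 'Z_n.
  by rewrite -!rmorphM -rmorphB /= det1.
split; rewrite -intr_Zp_eq0 //.
  by rewrite !rmorphB /= !chi_intr !rmorphD /= T addrAC addrK subrr.
by rewrite rmorphD rmorphB /= !chi_intr !rmorphN /= S addrAC subrK subrr.
Qed.

(** The two identities are statements about residues, hence a finite check; it
    is made modulo 3 and 4 separately, which shrinks it from 12^4 cases to
    3^4 + 4^4. *)
Lemma chi_step_mod12 (a b c d : int) : a * d - b * c = 1 ->
  (12 %| chi a (a + b) c (c + d) - chi a b c d - 1)%Z /\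
  (12 %| chi b (- a) d (- c) - chi a b c d + 3)%Z.
Proof.
move=> det1.
have steps3 : forall a b c d, @chi_steps 3 a b c d.
  by apply: chi_steps_ZpP; vm_compute.
have steps4 : forall a b c d, @chi_steps 4 a b c d.
  by apply: chi_steps_ZpP; vm_compute.
have [T3 S3] := chi_stepsP (isT : 1 < 3)%N steps3 det1.
have [T4 S4] := chi_stepsP (isT : 1 < 4)%N steps4 det1.
have mod12 x : (3 %| x)%Z -> (4 %| x)%Z -> (12 %| x)%Z by lia.
by split; apply: mod12.
Qed.

Lemma chi_even_shear (a b c d : int) : a * d - b * c = 1 ->
  (12 %| chi a (2 * a + b) c (2 * c + d) - chi a b c d - 2)%Z.
Proof.
move=> det1; have [T _] := chi_step_mod12 det1.
have det1' : a * (c + d) - (a + b) * c = 1 by rewrite -[RHS]det1; ring.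
have [+ _] := chi_step_mod12 det1'.
have -> : a + (a + b) = 2 * a + b by ring.
have -> : c + (c + d) = 2 * c + d by ring.
by lia.
Qed.

(** * Parity of integers *)

Definition oddz (a : int) : bool := odd `|a|.

Lemma oddzD a b : oddz (a + b) = oddz a (+) oddz b.
Proof. rewrite /oddz; lia. Qed.
Lemma oddzN a : oddz (- a) = oddz a. Proof. by rewrite /oddz abszN. Qed.
Lemma oddzM a b : oddz (a * b) = oddz a && oddz b.
Proof. by rewrite /oddz abszM oddM. Qed.

(** * The exponent of T^2 on the theta group *)

(** Signed number of factors T^2 in a theta matrix (a b; c d), read off from the
    Euclidean algorithm with even quotients on its first row. Replacing b by
    b - 2 e a is right multiplication by T^(-2e), so it accounts for e factors;
    replacing a by a - 2 e b is right multiplication by S T^(2e) S^-1, so it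
    accounts for -e factors. The algorithm ends with a = 0, where the matrix is
    S T^(-bd) up to sign, or with b = 0, where it is S T^(-ac) S^-1 up to sign.
    Reducing whichever entry is the larger one, instead of always exchanging
    the columns first, keeps the recursion symmetric under S. *)
Fixpoint shear_count_fuel (fuel : nat) (a b c d : int) : int :=
  if fuel is n.+1 then
    if a == 0 then - (b * d %/ 2)%Z
    else if b == 0 then - (a * c %/ 2)%Z
    else if `|a| < `|b| then
      sgz (a * b) + shear_count_fuel n
        a (b - 2 * sgz (a * b) * a) c (d - 2 * sgz (a * b) * c)
    else
      - sgz (a * b) + shear_count_fuel n
        (a - 2 * sgz (a * b) * b) b (c - 2 * sgz (a * b) * d) d
  else 0.

Lemma even_shear_lt (a b : int) : a != 0 -> `|a| < `|b| ->
  (absz (b - 2 * sgz (a * b) * a)%R < absz b)%N.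
Proof. by move=> a0 ltab; case: sgzP => ab; nia. Qed.

(** A first row of mixed parity never has |a| = |b|, which is the case where an
    even quotient fails to reduce the larger entry. *)
Lemma eq_shear_count_fuel n n' a b c d :
    (absz a + absz b < n)%N -> (absz a + absz b < n')%N -> oddz a != oddz b ->
  shear_count_fuel n a b c d = shear_count_fuel n' a b c d.
Proof.
elim: n n' a b c d => [|n IHn] [|n'] a b c d //= ltn ltn' ab_par.
have [//|a0] := eqVneq; have [//|b0] := eqVneq.
have ab_neq : `|a| != `|b| by apply: contra ab_par; rewrite /oddz; lia.
case: ifP => ltab; congr (_ + _).
  have := even_shear_lt a0 ltab.
  have : oddz a != oddz (b - 2 * sgz (a * b) * a).
    by rewrite oddzD oddzN !oddzM /= addbF.
  by move: (b - _) => b' par' lt'; apply: IHn => //; lia.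
have ltba : `|b| < `|a| by lia.
have := even_shear_lt b0 ltba; rewrite [b * a]mulrC.
have : oddz (a - 2 * sgz (a * b) * b) != oddz b.
  by rewrite oddzD oddzN !oddzM /= addbF.
by move: (a - _) => a' par' lt'; apply: IHn => //; lia.
Qed.

Definition shear_count (a b c d : int) : int :=
  shear_count_fuel (absz a + absz b).+1 a b c d.

Lemma shear_count0l b c d : shear_count 0 b c d = - (b * d %/ 2)%Z.
Proof. by []. Qed.

Lemma shear_count0r a c d : a != 0 -> shear_count a 0 c d = - (a * c %/ 2)%Z.
Proof. by rewrite /shear_count /= => /negPf->. Qed.

Lemma shear_countr (a b c d : int) :
    a != 0 -> `|a| < `|b| -> oddz a != oddz b ->
  shear_count a b c d = sgz (a * b) +
    shear_count a (b - 2 * sgz (a * b) * a) c (d - 2 * sgz (a * b) * c).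
Proof.
move=> a0 ltab par; rewrite /shear_count [in LHS]/= (negPf a0) ltab.
have /negPf-> : b != 0 by apply: contraTneq ltab => ->; rewrite normr0 -leNgt.
congr (_ + _); have := even_shear_lt a0 ltab.
have : oddz a != oddz (b - 2 * sgz (a * b) * a).
  by rewrite oddzD oddzN !oddzM /= addbF.
by move: (b - _) => b' par' lt'; apply: eq_shear_count_fuel => //; lia.
Qed.

Lemma shear_countl (a b c d : int) :
    b != 0 -> `|b| < `|a| -> oddz a != oddz b ->
  shear_count a b c d = - sgz (a * b) +
    shear_count (a - 2 * sgz (a * b) * b) b (c - 2 * sgz (a * b) * d) d.
Proof.
move=> b0 ltba par; rewrite /shear_count [in LHS]/= (negPf b0).
have /negPf-> : a != 0 by apply: contraTneq ltba => ->; rewrite normr0 -leNgt.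
rewrite (le_gtF (ltW ltba)); congr (_ + _); have := even_shear_lt b0 ltba.
have : oddz (a - 2 * sgz (a * b) * b) != oddz b.
  by rewrite oddzD oddzN !oddzM /= addbF.
rewrite [b * a]mulrC.
by move: (a - _) => a' par' lt'; apply: eq_shear_count_fuel => //; lia.
Qed.

(** Induction along the Euclidean algorithm. *)
Lemma norm_lt_ind (P : int -> int -> Prop) :
    (forall a b,
      (forall a' b', (absz a' + absz b' < absz a + absz b)%N -> P a' b') ->
      P a b) ->
  forall a b, P a b.
Proof.
move=> IH a b; have [n] := ubnP (absz a + absz b)%N.
elim: n a b => // n IHn a b lt_n; apply: IH => a' b' lt'; apply: IHn; lia.
Qed.

(** S exchanges the two branches of the Euclidean algorithm and changes the sign
    of a b, so every step contributes the same on both sides. *)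
Lemma shear_count_rot (a b c d : int) : oddz a != oddz b ->
  shear_count b (- a) d (- c) = shear_count a b c d.
Proof.
move: a b c d; apply: norm_lt_ind => a b IH c d par.
have [a0|a0] := eqVneq a 0.
  have b0 : b != 0 by move: par; rewrite a0; apply: contraNneq => ->.
  by rewrite a0 oppr0 shear_count0l shear_count0r.
have [b0|b0] := eqVneq b 0.
  by rewrite b0 shear_count0l shear_count0r // mulrNN.
have par' : oddz b != oddz (- a) by rewrite oddzN eq_sym.
have ab_neq : `|a| != `|b| by apply: contra par; rewrite /oddz; lia.
have [ltab|leba] := ltP `|a| `|b|.
  rewrite (shear_countr _ _ a0 ltab par).
  rewrite shear_countl ?oppr_eq0 ?normrN // mulrN [b * a]mulrC sgzN opprK.
  congr (_ + _); rewrite !(mulrN, mulNr, opprK).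
  apply: IH; last by rewrite oddzD oddzN !oddzM /= addbF.
  have := even_shear_lt a0 ltab; lia.
have ltba : `|b| < `|a| by rewrite lt_neqAle eq_sym ab_neq.
rewrite (shear_countl _ _ b0 ltba par).
rewrite shear_countr ?normrN // mulrN [b * a]mulrC sgzN.
congr (_ + _); rewrite !(mulrN, mulNr, opprK).
have -> : - a + 2 * sgz (a * b) * b = - (a - 2 * sgz (a * b) * b) by ring.
have -> : - c + 2 * sgz (a * b) * d = - (c - 2 * sgz (a * b) * d) by ring.
apply: IH; last by rewrite oddzD oddzN !oddzM /= addbF.
have := even_shear_lt b0 ltba; rewrite [b * a]mulrC; lia.
Qed.

(** Of the two rows (a, b) and (a, 2a + b), with a <> 0, one is obtained from
    the other by the first step of the algorithm. *)
Lemma shear_count_shear (a b c d : int) :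
    a * d - b * c = 1 -> oddz a != oddz b ->
  shear_count a (2 * a + b) c (2 * c + d) = shear_count a b c d + 1.
Proof.
move=> det1 par.
have par' : oddz a != oddz (2 * a + b) by rewrite oddzD oddzM.
have [a0|a0] := eqVneq a 0.
  rewrite a0 !shear_count0l !mulr0 add0r mulrDr.
  have -> : b * (2 * c) = -2 by move: det1; rewrite a0 mul0r; lia.
  lia.
have [ltab|leba] := ltP `|a| `|2 * a + b|; last first.
  (* Here (a, b) is the row that reduces to (a, 2a + b). *)
  have sg : sgz (a * b) = -1 by apply/eqP; rewrite sgz_cp0; nia.
  have ltb : `|a| < `|b| by move: par'; rewrite /oddz; lia.
  by rewrite [in RHS]shear_countr // sg !mulrN1 !mulNr !opprK addrAC addNr add0r
    [b + _]addrC [d + _]addrC.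
case: (ltrgt0P (a * (2 * a + b))) => sg.
- rewrite shear_countr // (eqP (_ : sgz (a * (2 * a + b)) == 1)) ?sgz_cp0 //.
  by rewrite !mulr1 ![2 * _ + _]addrC !addrK addrC.
- (* The sign of a b is opposite, so again (a, b) is the longer row. *)
  have sg' : sgz (a * b) = -1 by apply/eqP; rewrite sgz_cp0; nia.
  have ltb : `|a| < `|b| by nia.
  rewrite [in RHS]shear_countr // sg' !mulrN1 !mulNr !opprK addrAC addNr.
  by rewrite add0r [b + _]addrC [d + _]addrC.
- move/eqP: sg; rewrite mulf_eq0 (negPf a0) /= => /eqP sg.
  by move: ltab; rewrite sg normr0 ltNge normr_ge0.
Qed.

(** * Generation by Euclidean descent *)

Lemma oddz_theta_row (a b c d : int) :
  a * d - b * c = 1 -> ~~ oddz (a * c) -> ~~ oddz (b * d) -> oddz a != oddz b.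
Proof.
move=> /(congr1 oddz); rewrite oddzD oddzN !oddzM.
by case: (oddz a) (oddz b) (oddz c) (oddz d) => [] [] [] [].
Qed.

Lemma intz_mul_eq1 (x y : int) : x * y = 1 -> `|x| = 1 /\ y = x.
Proof.
move=> xy1; have /eqP := congr1 absz xy1; rewrite abszM muln_eq1 => /andP[].
move=> /eqP x1 /eqP y1; have [xE|xE] : x = 1 \/ x = -1 by lia.
  by move: xy1; rewrite xE mul1r.
by move: xy1; rewrite xE mulN1r => /(canRL opprK).
Qed.

(** Generation of the theta group by S and T^2, in terms of entries: the
    Euclidean algorithm with even quotients brings the first row to (0, +-1),
    and then even multiples of b can be removed from d as well. The hypotheses
    are descent steps: each deduces [P] at a matrix from [P] at its product with
    a generator or the inverse of one. *)
Lemma theta_descent (P : int -> int -> int -> int -> Prop) :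
    P 1 0 0 1 ->
    (forall a b c d : int, P b (- a) d (- c) -> P a b c d) ->
    (forall a b c d : int, P a (2 * a + b) c (2 * c + d) -> P a b c d) ->
    (forall a b c d : int, P a (b - 2 * a) c (d - 2 * c) -> P a b c d) ->
  forall a b c d : int,
    a * d - b * c = 1 -> ~~ oddz (a * c) -> ~~ oddz (b * d) -> P a b c d.
Proof.
move=> P1 PS PT PTV.
(* Matrices with a = 0, by descent on d. *)
have P_cusp (b c d : int) : `|b| = 1 -> c = - b -> ~~ oddz d -> P 0 b c d.
  move=> b1 ->; have [n] := ubnP (absz d); elim: n d => // n IHn d lt_n d_even.
  have [->|d0] := eqVneq d 0.
    have P01 : P 0 1 (-1) 0 by apply: PS; rewrite !oppr0 !opprK.
    have [->//|->] : b = 1 \/ b = -1 by lia.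
    by do 2!apply: (PS); rewrite !oppr0 !opprK.
  have d2 : (2 <= absz d)%N by move: d_even d0; rewrite /oddz; lia.
  have [bd|bd] : b * d > 0 \/ b * d < 0 by nia.
    apply: PT; rewrite mulr0 add0r; apply: IHn; first nia.
    by rewrite oddzD oddzM.
  apply: PTV; rewrite mulr0 subr0; apply: IHn; first nia.
  by rewrite oddzD oddzN oddzM addbF.
apply: norm_lt_ind => a b IH c d det1 ac bd.
have par := oddz_theta_row det1 ac bd.
have ab_neq : `|a| != `|b| by apply: contra par; rewrite /oddz; lia.
have [a0|a0] := eqVneq a 0.
  have [b1 bc] : `|b| = 1 /\ c = - b.
    move: det1; rewrite a0 mul0r sub0r -mulrN => /intz_mul_eq1[b1 cb].
    by split; rewrite // -cb opprK.
  by rewrite a0; apply: P_cusp => //; move: bd; rewrite oddzM /oddz; lia.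
have [b0|b0] := eqVneq b 0.
  have [a1 da] : `|a| = 1 /\ d = a.
    by move: det1; rewrite b0 mul0r subr0 => /intz_mul_eq1.
  apply: PS; rewrite b0 da; apply: P_cusp; rewrite ?normrN ?opprK ?oddzN //.
  by move: ac; rewrite oddzM /oddz; lia.
have [ltab|leba] := ltP `|a| `|b|.
  have [ab|ab] : a * b > 0 \/ a * b < 0 by nia.
    apply: PTV; apply: IH => //; first nia.
      by rewrite -[RHS]det1; ring.
    by move: bd; rewrite !oddzM !oddzD !oddzN !oddzM /= !addbF.
  apply: PT; apply: IH => //; first nia.
    by rewrite -[RHS]det1; ring.
  by move: bd; rewrite !oddzM !oddzD !oddzM.
have ltba : `|b| < `|a| by rewrite lt_neqAle eq_sym ab_neq.
apply: PS; have [ab|ab] : a * b > 0 \/ a * b < 0 by nia.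
  apply: PT; apply: IH => //; first nia.
    by rewrite -[RHS]det1; ring.
  by move: ac; rewrite !oddzM !oddzD !oddzN !oddzM.
apply: PTV; apply: IH => //; first nia.
  by rewrite -[RHS]det1; ring.
by move: ac; rewrite !oddzM !oddzD !oddzN !oddzM /= !addbF.
Qed.

(** The theta group has index 3, and for each g one of g, g T and g S T lies in
    it, as the reductions modulo 2 show; so this follows from its generation by
    S and T^2. *)
Lemma SL2_descent (P : int -> int -> int -> int -> Prop) :
    P 1 0 0 1 ->
    (forall a b c d : int, P b (- a) d (- c) -> P a b c d) ->
    (forall a b c d : int, P a (a + b) c (c + d) -> P a b c d) ->
    (forall a b c d : int, P a (b - a) c (d - c) -> P a b c d) ->
  forall a b c d : int, a * d - b * c = 1 -> P a b c d.
Proof.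
move=> P1 PS PT PTV.
have P_theta : forall a b c d : int, a * d - b * c = 1 -> ~~ oddz (a * c) ->
    ~~ oddz (b * d) -> P a b c d.
  apply: theta_descent => // a b c d; rewrite ?mulr_natl ?mulr2n.
    by rewrite -!addrA => Pg; apply/PT/PT.
  by rewrite !opprD !addrA => Pg; apply/PTV/PTV.
move=> a b c d det1.
have detT : a * (c + d) - (a + b) * c = 1 by rewrite -[RHS]det1; ring.
have [exc|] := boolP (oddz (a * c) || oddz (b * d)); last first.
  by rewrite negb_or => /andP[]; apply: P_theta.
have := congr1 oddz det1; rewrite oddzD oddzN !oddzM => det1_odd.
have [/andP[ac bdT]|nT] :=
    boolP (~~ oddz (a * c) && ~~ oddz ((a + b) * (c + d))).
  by apply/PT/P_theta.
apply: PS; apply: PT; apply: P_theta.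
- by rewrite -[RHS]det1; ring.
- move: nT det1_odd exc; rewrite !(oddzM, oddzD, oddzN).
  by case: (oddz a) (oddz b) (oddz c) (oddz d) => [] [] [] [].
- move: nT det1_odd exc; rewrite !(oddzM, oddzD, oddzN).
  by case: (oddz a) (oddz b) (oddz c) (oddz d) => [] [] [] [].
Qed.

(** * Abelianizations of the two matrix groups *)

Lemma mx22_mul a b c d a' b' c' d' : mx22 a b c d *m mx22 a' b' c' d' =
  mx22 (a * a' + b * c') (a * b' + b * d') (c * a' + d * c') (c * b' + d * d').
Proof.
by apply/matrixP => i j; rewrite !mxE !big_ord_recl big_ord0 addr0 !mxE /=;
  case: ifP => _; case: ifP.
Qed.

Lemma mx22_1 : 1%:M = mx22 1 0 0 1.
Proof.
by apply/matrixP => i j; rewrite !mxE; case: i j => [[|[]]] // ? [[|[]]].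
Qed.

Lemma mx22E (M : 'M[int]_2) : M = mx22 (M 0 0) (M 0 1) (M 1 0) (M 1 1).
Proof.
apply/matrixP => i j; rewrite !mxE.
by case: i j => [[|[]]] // ? [[|[]]] // ?; congr (M _ _); apply: val_inj.
Qed.

(** The group is kept abstract, with a faithful representation [rho], so that
    the same result serves Sp_2(Z) and the stabilizer of q_(1,1). *)
Section MatrixGroup.
Variables (G : groupType) (rho : G -> 'M[int]_2).
Hypothesis rho1 : rho 1%g = mx22 1 0 0 1.
Hypothesis rhoM : forall g h, rho (g * h)%g = rho g *m rho h.
Hypothesis rho_inj : injective rho.
Hypothesis rho_det : forall g a b c d,
  rho g = mx22 a b c d -> a * d - b * c = 1.
Variable s : G.
Hypothesis rho_s : rho s = mx22 0 (-1) 1 0.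

Lemma mulg_s g a b c d :
  rho g = mx22 a b c d -> rho (g * s)%g = mx22 b (- a) d (- c).
Proof. by move=> gE; rewrite rhoM gE rho_s mx22_mul; congr mx22; ring. Qed.

Lemma mulg_t n t g a b c d : rho t = mx22 1 n 0 1 ->
  rho g = mx22 a b c d -> rho (g * t)%g = mx22 a (n * a + b) c (n * c + d).
Proof.
by move=> rho_t gE; rewrite rhoM gE rho_t mx22_mul; congr mx22; ring.
Qed.

Lemma inv_t n t : rho t = mx22 1 n 0 1 -> rho t^-1%g = mx22 1 (- n) 0 1.
Proof.
move=> rho_t; have tV : mx22 1 n 0 1 *m mx22 1 (- n) 0 1 = 1%:M.
  by rewrite mx22_1 mx22_mul; congr mx22; ring.
by rewrite -[LHS]mulmx1 -tV mulmxA -rho_t -rhoM mulVg rho1 -mx22_1 mul1mx.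
Qed.

Lemma s_order4 : (s * s * s * s = 1)%g.
Proof. by apply: rho_inj; rewrite !rhoM rho_s rho1 !mx22_mul; congr mx22. Qed.

Lemma H1_s_torsion : H1_class s *+ 4 = 0.
Proof.
have := congr1 (@H1_class G) s_order4; rewrite !H1_classM H1_class1.
by rewrite !mulrSr mulr0n add0r.
Qed.

Section Full.
Variable t : G.
Hypothesis rho_t : rho t = mx22 1 1 0 1.

Lemma SL2_generated : generated_by2 s t.
Proof.
move=> P P1 Ps Pt.
suff Pmx a b c d : a * d - b * c = 1 -> forall g, rho g = mx22 a b c d -> P g.
  by move=> g; have gE := mx22E (rho g); apply: Pmx (rho_det gE) _ gE.
move: a b c d.
apply: SL2_descent => [g gE|a b c d IH g gE|a b c d IH g gE|a b c d IH g gE].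
- by have -> : g = 1%g by apply: rho_inj; rewrite gE rho1.
- by apply/Ps/IH; rewrite (mulg_s gE).
- by apply/Pt/IH; rewrite (mulg_t rho_t gE) !mul1r.
- rewrite -[g](mulgVK t); apply/Pt/IH; rewrite (mulg_t (inv_t rho_t) gE).
  by congr mx22; ring.
Qed.

(** The relation (S T)^3 = S^2, abelianized. *)
Lemma H1_s_SL2 : H1_class s = - (H1_class t *+ 3).
Proof.
have braid : (s * t * (s * t) * (s * t) = s * s)%g.
  by apply: rho_inj; rewrite !rhoM rho_s rho_t !mx22_mul; congr mx22.
have := congr1 (@H1_class G) braid; rewrite !H1_classM.
move: (H1_class s) (H1_class t) => x y.
have -> : x + y + (x + y) + (x + y) = (x + y) *+ 3.
  by rewrite !mulrSr mulr0n add0r.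
rewrite -mulr2n mulrnDl mulrSr addrAC -addrA -[RHS]addr0 => /addrI/eqP.
by rewrite addrC addr_eq0 => /eqP.
Qed.

Definition chi12 (g : G) : 'Z_12 :=
  (chi (rho g 0 0) (rho g 0 1) (rho g 1 0) (rho g 1 1))%:~R.

Lemma chi12E g a b c d : rho g = mx22 a b c d -> chi12 g = (chi a b c d)%:~R.
Proof. by move=> gE; rewrite /chi12 gE !mxE. Qed.

Lemma chi12M g h : chi12 (g * h)%g = chi12 g + chi12 h.
Proof.
have chi1 : chi12 1%g = 0 by rewrite (chi12E rho1).
have chi_s : chi12 s = -3 by rewrite (chi12E rho_s).
have chi_t : chi12 t = 1 by rewrite (chi12E rho_t).
apply: (gen2_morphism SL2_generated chi1) => {}g; have gE := mx22E (rho g).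
  have [_] := chi_step_mod12 (rho_det gE); rewrite -intr_Zp_eq0 //.
  rewrite (chi12E gE) (chi12E (mulg_s gE)) chi_s.
  by rewrite rmorphD rmorphB /= addrAC subr_eq0 => /eqP <-; rewrite addrK.
have [+ _] := chi_step_mod12 (rho_det gE); rewrite -intr_Zp_eq0 //.
rewrite (chi12E gE) (chi12E (mulg_t rho_t gE)) chi_t !mul1r.
by rewrite !rmorphB /= -addrA -opprD subr_eq0 => /eqP.
Qed.

(** In the abelianization S = T^-3 and S^4 = 1, so T generates and 12 kills it;
    the character of order 12 shows that nothing smaller does. *)
Theorem H1_SL2 :
  exists f : {additive 'Z_12 -> H1 G}, bijective f /\ f 1 = H1_class t.
Proof.
have t12 : H1_class t *+ 12 = 0.
  by rewrite (mulrnA _ 3 4) -[_ *+ 3]opprK -H1_s_SL2 mulNrn H1_s_torsion oppr0.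
have [f f1] := Zp_lift (isT : 1 < 12)%N t12; exists f; split=> //.
have chi_t : chi12 t = 1 by rewrite (chi12E rho_t).
apply: (H1_bijective chi12M) => [k|].
  by exists (t ^+ k)%g; rewrite (morph_mulX chi12M) chi_t natr_Zp.
apply: (gen2_eq SL2_generated) => [g h|g h||].
- by rewrite chi12M raddfD.
- exact: H1_classM.
- rewrite (chi12E rho_s) H1_s_SL2 -f1 -mulNrn -raddfN -raddfMn /=.
  by congr (f _); apply: val_inj.
- by rewrite chi_t.
Qed.

End Full.

Section Theta.
Variable t : G.
Hypothesis rho_t : rho t = mx22 1 2 0 1.
Hypothesis theta : forall g a b c d, rho g = mx22 a b c d ->
  ~~ oddz (a * c) /\ ~~ oddz (b * d).

Lemma theta_generated : generated_by2 s t.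
Proof.
move=> P P1 Ps Pt.
suff Pmx a b c d : a * d - b * c = 1 -> ~~ oddz (a * c) -> ~~ oddz (b * d) ->
    forall g, rho g = mx22 a b c d -> P g.
  move=> g; have gE := mx22E (rho g); have [ac bd] := theta gE.
  exact: Pmx (rho_det gE) ac bd _ gE.
move: a b c d.
apply: theta_descent => [g gE|a b c d IH g gE|a b c d IH g gE|a b c d IH g gE].
- by have -> : g = 1%g by apply: rho_inj; rewrite gE rho1.
- by apply/Ps/IH; rewrite (mulg_s gE).
- by apply/Pt/IH; rewrite (mulg_t rho_t gE).
- rewrite -[g](mulgVK t); apply/Pt/IH; rewrite (mulg_t (inv_t rho_t) gE).
  by congr mx22; ring.
Qed.

(** The second component is the character with values 1 at S and 0 at T^2: the
    reduction of [chi] modulo 4 takes the value -3 = 1 at S but 2 at T^2, and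
    the multiple of the shear count compensates the latter. *)
Definition theta_char (g : G) : int * 'Z_4 :=
  let n := shear_count (rho g 0 0) (rho g 0 1) (rho g 1 0) (rho g 1 1) in
  (n, (chi (rho g 0 0) (rho g 0 1) (rho g 1 0) (rho g 1 1) - 2 * n)%:~R).

Lemma theta_charE g a b c d : rho g = mx22 a b c d ->
  theta_char g = (shear_count a b c d,
    (chi a b c d - 2 * shear_count a b c d)%:~R).
Proof. by move=> gE; rewrite /theta_char gE !mxE. Qed.

Lemma theta_char_s : theta_char s = (0, 1).
Proof. by rewrite (theta_charE rho_s); congr (_, _); apply: val_inj. Qed.

Lemma theta_char_t : theta_char t = (1, 0).
Proof. by rewrite (theta_charE rho_t); congr (_, _); apply: val_inj. Qed.

Lemma theta_charM g h : theta_char (g * h)%g = theta_char g + theta_char h.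
Proof.
have intr4 (k x y : int) : (4 %| x - y - k)%Z -> x%:~R = y%:~R + k%:~R :> 'Z_4.
  by rewrite -intr_Zp_eq0 // !rmorphB /= -addrA -opprD subr_eq0 => /eqP ->.
have char1 : theta_char 1%g = 0.
  by rewrite (theta_charE rho1); congr (_, _); apply: val_inj.
apply: (gen2_morphism theta_generated char1) => {}g; have gE := mx22E (rho g).
  rewrite theta_char_s (theta_charE gE) (theta_charE (mulg_s gE)).
  have [ac bd] := theta gE; have par := oddz_theta_row (rho_det gE) ac bd.
  rewrite shear_count_rot //; congr (_, _); first by rewrite addr0.
  have [_ chi_s] := chi_step_mod12 (rho_det gE).
  by apply: (intr4 1); lia.
rewrite theta_char_t (theta_charE gE) (theta_charE (mulg_t rho_t gE)).
have [ac bd] := theta gE; have par := oddz_theta_row (rho_det gE) ac bd.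
rewrite (shear_count_shear (rho_det gE) par); congr (_, _).
apply: (intr4 0).
have := chi_even_shear (rho_det gE).
by lia.
Qed.

(** The theta group is Z/4 amalgamated with Z/2 x Z along Z/2 = {1, -1}, whence
    the shape of the answer; the argument uses only generation, S^4 = 1
    and the character [theta_char]. *)
Theorem H1_theta : exists f : {additive (int * 'Z_4)%type -> H1 G},
  bijective f /\ f (1, 0) = H1_class t /\ f (0, 1) = H1_class s.
Proof.
have [f [f_t f_s]] := intZp_lift (H1_class t) (isT : 1 < 4)%N H1_s_torsion.
exists f; split=> //; apply: (H1_bijective theta_charM) => [[n k]|].
  pose tn := if n is Negz m then (t^-1 ^+ m.+1)%g else (t ^+ absz n)%g.
  have tnE : theta_char tn = (n, 0).
    rewrite /tn; case: (n) => m; rewrite (morph_mulX theta_charM)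
      ?(morph_mulV theta_charM) theta_char_t ?mulNrn pairMn mul0rn.
      by rewrite natz.
    by rewrite NegzE -[(m.+1)%:Z]natz; congr (_, _); apply: oppr0.
  exists (tn * s ^+ k)%g.
  rewrite theta_charM tnE (morph_mulX theta_charM) theta_char_s pairMn mul0rn.
  by rewrite natr_Zp; congr (_, _); [apply: addr0|apply: add0r].
apply: (gen2_eq theta_generated) => [g h|g h||].
- by rewrite theta_charM raddfD.
- exact: H1_classM.
- by rewrite theta_char_s.
- by rewrite theta_char_t.
Qed.

End Theta.
End MatrixGroup.

(** * Stabilizers of quadratic refinements *)

Lemma Sp2_det (g : Sp2) a b c d : val g = mx22 a b c d -> a * d - b * c = 1.
Proof.
move=> gE; case/andP: (valP g) => _ /asboolP/(_ alpha beta).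
rewrite !omega1E gE /alpha /beta -!colE !mxE /=; lia.
Qed.

Lemma mx22_symplectic a b c d :
  a * d - b * c = 1 -> mx22 a b c d \in symplectic.
Proof.
move=> det1; apply/andP; split.
  have: mx22 a b c d *m mx22 d (- b) (- c) a = 1%:M.
    by rewrite mx22_mul mx22_1; congr mx22; rewrite -?det1; ring.
  by case/mulmx1_unit.
apply/asboolP => x y.
rewrite !omega1E !mxE !big_ord_recl !big_ord0 !addr0 !mxE /=.
have -> : fintype.lift ord0 ord0 = 1 :> 'I_2 by apply: val_inj.
have -> : ord0 = 0 :> 'I_2 by apply: val_inj.
rewrite -[RHS]mul1r -det1; ring.
Qed.

Lemma quad_act_mx22 (k l : 'Z_2) (g : Sp2) a b c d : val g = mx22 a b c d ->
  quad_act (quad_ij k l) g =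
    quad_ij (k * a%:~R + l * c%:~R + a%:~R * c%:~R)
            (k * b%:~R + l * d%:~R + b%:~R * d%:~R).
Proof.
by move=> gE; rewrite [LHS]quad_ij_unique /= gE /alpha /beta -!colE !mxE /=.
Qed.

Lemma intr_Z2 (x : int) : x%:~R = (oddz x)%:R :> 'Z_2.
Proof.
apply/eqP; rewrite -subr_eq0 -(rmorph_nat (intmul 1)) -rmorphB /=.
by rewrite intr_Zp_eq0 // /oddz; lia.
Qed.

Lemma quad_ij_inj k l k' l' : quad_ij k l = quad_ij k' l' -> k = k' /\ l = l'.
Proof.
move=> e; split.
  by rewrite -(quad_ij_alpha k l) e quad_ij_alpha.
by rewrite -(quad_ij_beta k l) e quad_ij_beta.
Qed.

(** The right-hand side evaluates q_(0,0) on the two columns of g. *)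
Lemma stabilizer00 (g : Sp2) a b c d : val g = mx22 a b c d ->
  (g \in stabilizer (quad_ij 0 0)) = ~~ oddz (a * c) && ~~ oddz (b * d).
Proof.
move=> gE; rewrite unfold_in (quad_act_mx22 _ _ gE) !mul0r !add0r.
rewrite !intr_Z2 !oddzM.
apply/asboolP/idP => [/quad_ij_inj[]|].
  by case: (oddz a) (oddz b) (oddz c) (oddz d) => [] [] [] [].
by move=> abcd; congr quad_ij; apply: val_inj; move: abcd;
  case: (oddz a) (oddz b) (oddz c) (oddz d) => [] [] [] [].
Qed.

(** q_(1,1) is the only refinement of Arf invariant 1: it takes the value 1 on
    every vector that is nonzero modulo 2, in particular on the columns of g. *)
Lemma stabilizer11 (g : Sp2) : g \in stabilizer (quad_ij 1 1).
Proof.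
have gE := mx22E (val g); have := congr1 oddz (Sp2_det gE).
rewrite oddzD oddzN !oddzM unfold_in (quad_act_mx22 _ _ gE) !mul1r !intr_Z2.
move: (oddz _) (oddz _) (oddz _) (oddz _) => [] [] [] [] //= _;
  by apply/asboolP; congr quad_ij; apply: val_inj.
Qed.

Theorem theorem7p6 :
  (exists t : Sp2, Sp2val t = mx22 1 1 0 1 /\
     exists f : {additive 'Z_12 -> H1 Sp2},
       bijective f /\ f 1 = H1_class t)
  /\
  (exists mu lambda : Sp2_0,
     Sp2val (Stabval mu) = mx22 1 2 0 1 /\
     Sp2val (Stabval lambda) = mx22 0 (-1) 1 0 /\
     exists f : {additive (int * 'Z_4)%type -> H1 Sp2_0},
       bijective f /\ f (1, 0) = H1_class mu /\ f (0, 1) = H1_class lambda)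
  /\
  (exists t' : Sp2_1, Sp2val (Stabval t') = mx22 1 1 0 1 /\
     exists f : {additive 'Z_12 -> H1 Sp2_1},
       bijective f /\ f 1 = H1_class t').
Proof.
pose S : Sp2 := MkSp2 (mx22_symplectic (erefl : 0 * 0 - (-1) * 1 = 1 :> int)).
pose T : Sp2 := MkSp2 (mx22_symplectic (erefl : 1 * 1 - 1 * 0 = 1 :> int)).
pose T2 : Sp2 := MkSp2 (mx22_symplectic (erefl : 1 * 1 - 2 * 0 = 1 :> int)).
have one q : val (val (1%g : Stab q)) = mx22 1 0 0 1 by rewrite -mx22_1.
have inj q : injective (fun g : Stab q => val (val g)).
  by move=> g h /val_inj/val_inj.
split; [|split].
- exists T; split=> //.
  exact: (@H1_SL2 Sp2 val mx22_1 _ val_inj Sp2_det S).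
- have S0 : S \in stabilizer (quad_ij 0 0).
    by rewrite (@stabilizer00 _ 0 (-1) 1 0).
  have T0 : T2 \in stabilizer (quad_ij 0 0).
    by rewrite (@stabilizer00 _ 1 2 0 1).
  exists (MkStab T0), (MkStab S0); do 2!split=> //.
  apply: (@H1_theta Sp2_0 (fun g => val (val g))) => //.
  + exact: inj.
  + by move=> g a b c d; apply: Sp2_det.
  + move=> g a b c d gE; apply/andP; rewrite -(stabilizer00 gE); exact: valP g.
- exists (MkStab (stabilizer11 T)); split=> //.
  apply: (@H1_SL2 Sp2_1 (fun g => val (val g)) _ _ _ _
    (MkStab (stabilizer11 S))) => //.
  + exact: inj.
  + by move=> g a b c d; apply: Sp2_det.
Qed.
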